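(* Let $V$ be a valuation ring with value group $\Gamma$. There is a countable sequence of ultrafilters $\mathscr{U}_1,\mathscr{U}_2,\dots$ on some respective sets $U_1,U_2,\dots$ for which the valuation rings $\{V_n\}_{n\ge 0}$ defined inductively by $V_0:=V$ and $V_{n+1}:=\prod_{\mathscr{U}_{n+1}}V_n$ are such that the valuation ring $\widetilde V:=\varinjlim_{n\ge 0}V_n$ has a cross-section $\widetilde s:\widetilde\Gamma\to\widetilde K^*$, where $\widetilde K$ and $\widetilde\Gamma$ are the fraction field and the value group of $\widetilde V$.
   Context: For an ultrafilter $\mathscr{U}$ on a nonempty set $U$ and a ring $C$, the ultrapower $\prod_{\mathscr{U}}C$ is $\varinjlim_{U'\in\mathscr{U}}\prod_{u\in U'}C$, where the transition maps (for $U'\supseteq U''$) are the projections onto partial products. An ultrapower of a valuation ring is a valuation ring. The transition maps $V_n\to V_{n+1}$ are the diagonal maps. A cross-section of a valuation ring $W$ with fraction field $L$, value group $\Delta$ and valuation map $\mathrm{val}:L^*\to\Delta$ is a group homomorphism $s:\Delta\to L^*$ with $\mathrm{val}(s(\delta))=\delta$ for all $\delta\in\Delta$. *)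

(* Defs.v *)
From HB Require Import structures.
From mathcomp Require Import all_boot all_order all_algebra.
From mathcomp Require Import boolp classical_sets functions filter.

Set Implicit Arguments.
Unset Strict Implicit.
Unset Printing Implicit Defensive.

Import GRing.Theory.
Local Open Scope classical_set_scope.
Local Open Scope ring_scope.
Local Open Scope quotient_scope.

Notation tofrac := (@FracField.tofrac _).

HB.mixin Record IntegralDomain_isValuationRing V of GRing.IntegralDomain V := {
  frac_valuation : forall x : {fraction V}, x != 0 ->
    (exists a : V, x = tofrac a) \/ (exists a : V, x^-1 = tofrac a)
}.

#[short(type="valuationRingType")]
HB.structure Definition ValuationRing :=
  {V of GRing.IntegralDomain V & IntegralDomain_isValuationRing V}.

(** MathComp's [{unit R}] requires [R] to be finite, hence this definition of
    the group [K^*] for an arbitrary field. *)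
Section NonzeroGroup.
Variable K : fieldType.

Record nonzero := Nonzero { nz_val : K; nz_neq0 : nz_val != 0 }.

HB.instance Definition _ := [isSub for nz_val].
HB.instance Definition _ := [Choice of nonzero by <:].

Definition nz_one := Nonzero (oner_neq0 K).
Definition nz_mul (x y : nonzero) :=
  Nonzero (mulf_neq0 (nz_neq0 x) (nz_neq0 y)).
Lemma nz_inv_subproof (x : nonzero) : (nz_val x)^-1 != 0.
Proof. by rewrite invr_eq0 nz_neq0. Qed.
Definition nz_inv (x : nonzero) := Nonzero (nz_inv_subproof x).

Lemma nz_mulA : associative nz_mul.
Proof. by move=> x y z; apply: val_inj; rewrite /= mulrA. Qed.
Lemma nz_mul1 : left_id nz_one nz_mul.
Proof. by move=> x; apply: val_inj; rewrite /= mul1r. Qed.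
Lemma nz_1mul : right_id nz_one nz_mul.
Proof. by move=> x; apply: val_inj; rewrite /= mulr1. Qed.
Lemma nz_mulV : left_inverse nz_one nz_inv nz_mul.
Proof. by move=> x; apply: val_inj; rewrite /= mulVf // nz_neq0. Qed.
Lemma nz_Vmul : right_inverse nz_one nz_inv nz_mul.
Proof. by move=> x; apply: val_inj; rewrite /= mulfV // nz_neq0. Qed.

HB.instance Definition _ :=
  isGroup.Build nonzero nz_mulA nz_mul1 nz_1mul nz_mulV nz_Vmul.

Lemma nz_valM (x y : nonzero) : nz_val (x * y)%g = nz_val x * nz_val y.
Proof. by []. Qed.
Lemma nz_val1 : nz_val 1%g = 1.
Proof. by []. Qed.

End NonzeroGroup.

(** The value group [K^* / V^*], written multiplicatively. Its order plays no
    role for cross-sections, which are plain group homomorphisms. *)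
Section ValueGroup.
Variable V : valuationRingType.
Local Notation K := {fraction V}.

Definition same_value (x y : nonzero K) : bool :=
  `[< exists2 u : V, u \is a GRing.unit & nz_val x = tofrac u * nz_val y >].

Lemma same_value_refl : reflexive same_value.
Proof.
by move=> x; apply/asboolP; exists 1; rewrite ?unitr1 // rmorph1 mul1r.
Qed.

Lemma same_value_sym : symmetric same_value.
Proof.
suff h x y : same_value x y -> same_value y x.
  by move=> x y; apply/idP/idP; apply: h.
move=> /asboolP[u uU xy]; apply/asboolP; exists u^-1; first by rewrite unitrV.
by rewrite xy mulrA -rmorphM mulVr // rmorph1 mul1r.
Qed.

Lemma same_value_trans : transitive same_value.
Proof.
move=> y x z /asboolP[u uU xy] /asboolP[v vU yz]; apply/asboolP.
by exists (u * v); rewrite ?unitrM ?uU // xy yz rmorphM mulrA.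
Qed.

Canonical same_value_equiv :=
  EquivRel same_value same_value_refl same_value_sym same_value_trans.

Definition value_group := {eq_quot same_value}.
HB.instance Definition _ := EqQuotient.on value_group.
HB.instance Definition _ := Choice.on value_group.

Definition valuation (x : nonzero K) : value_group := \pi x.

Lemma valuationP x y : reflect
  (exists2 u : V, u \is a GRing.unit & nz_val x = tofrac u * nz_val y)
  (valuation x == valuation y).
Proof. by rewrite /valuation eqmodE; apply: asboolP. Qed.

Lemma valuation_repr (d : value_group) : valuation (repr d) = d.
Proof. exact: reprK. Qed.

Definition vg_one : value_group := valuation 1%g.
Definition vg_mul (a b : value_group) := valuation (repr a * repr b)%g.
Definition vg_inv (a : value_group) := valuation (repr a)^-1%g.

Lemma vg_mulE x y : vg_mul (valuation x) (valuation y) = valuation (x * y)%g.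
Proof.
apply/eqP/valuationP.
have /eqP/valuationP[u uU eu] := valuation_repr (valuation x).
have /eqP/valuationP[v vU ev] := valuation_repr (valuation y).
exists (u * v); first by rewrite unitrM uU.
by rewrite !nz_valM eu ev rmorphM mulrACA.
Qed.

Lemma vg_invE x : vg_inv (valuation x) = valuation x^-1%g.
Proof.
apply/eqP/valuationP.
have /eqP/valuationP[u uU eu] := valuation_repr (valuation x).
exists u^-1; first by rewrite unitrV.
by rewrite /= eu invfM rmorphV.
Qed.

Lemma vg_mulA : associative vg_mul.
Proof.
move=> a b c; rewrite -(valuation_repr a) -(valuation_repr b).
by rewrite -(valuation_repr c) !vg_mulE mulgA.
Qed.
Lemma vg_mul1 : left_id vg_one vg_mul.
Proof. by move=> a; rewrite -(valuation_repr a) vg_mulE mul1g. Qed.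
Lemma vg_1mul : right_id vg_one vg_mul.
Proof. by move=> a; rewrite -(valuation_repr a) vg_mulE mulg1. Qed.
Lemma vg_mulV : left_inverse vg_one vg_inv vg_mul.
Proof. by move=> a; rewrite -(valuation_repr a) vg_invE vg_mulE mulVg. Qed.
Lemma vg_Vmul : right_inverse vg_one vg_inv vg_mul.
Proof. by move=> a; rewrite -(valuation_repr a) vg_invE vg_mulE mulgV. Qed.

HB.instance Definition _ :=
  isGroup.Build value_group vg_mulA vg_mul1 vg_1mul vg_mulV vg_Vmul.

Lemma valuationM : {morph valuation : x y / (x * y)%g}.
Proof. by move=> x y; rewrite -vg_mulE. Qed.

HB.instance Definition _ :=
  isMultiplicative.Build (nonzero K) value_group valuation valuationM.

Definition is_cross_section (s : {multiplicative value_group -> nonzero K}) :=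
  forall d : value_group, valuation (s d) = d.

End ValueGroup.

Record directed_system := DirectedSystem {
  ds_idx : Type;
  ds_le : ds_idx -> ds_idx -> Prop;
  ds_idx0 : ds_idx;
  ds_refl : forall i, ds_le i i;
  ds_trans : forall i j k, ds_le i j -> ds_le j k -> ds_le i k;
  ds_directed : forall i j, exists k, ds_le i k /\ ds_le j k;
  ds_obj : ds_idx -> comPzRingType;
  ds_map : forall i j, ds_le i j -> {rmorphism ds_obj i -> ds_obj j};
  ds_map_id : forall i (h : ds_le i i) x, ds_map h x = x;
  ds_map_comp : forall i j k (hij : ds_le i j) (hjk : ds_le j k)
    (hik : ds_le i k) x, ds_map hjk (ds_map hij x) = ds_map hik x
}.

Section Colimit.
Variable D : directed_system.
Local Notation I := (ds_idx D).
Local Notation R := (ds_obj (d := D)).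
Local Notation le := (@ds_le D).

Definition germ := {classic {i : I & R i}}.
Definition mk_germ i (x : R i) : germ := existT _ i x.

Definition germ_eq (a b : germ) : bool :=
  `[< exists k (ha : le (projT1 a) k) (hb : le (projT1 b) k),
        ds_map ha (projT2 a) = ds_map hb (projT2 b) >].

Lemma germ_eq_refl : reflexive germ_eq.
Proof.
by move=> a; apply/asboolP; exists (projT1 a), (ds_refl _), (ds_refl _).
Qed.

Lemma germ_eq_sym : symmetric germ_eq.
Proof.
by move=> a b; apply/asboolP/asboolP => -[k [ha [hb e]]]; exists k, hb, ha.
Qed.

Lemma germ_eq_trans : transitive germ_eq.
Proof.
move=> b a c /asboolP[k [ha [hb e]]] /asboolP[l [hb' [hc e']]].
have [m [km lm]] := ds_directed k l; apply/asboolP.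
exists m, (ds_trans ha km), (ds_trans hc lm).
rewrite -(ds_map_comp ha km) e (ds_map_comp _ _ (ds_trans hb km)).
by rewrite -(ds_map_comp hb' lm) e' (ds_map_comp _ _ (ds_trans hc lm)).
Qed.

Canonical germ_equiv :=
  EquivRel germ_eq germ_eq_refl germ_eq_sym germ_eq_trans.

Definition colim := {eq_quot germ_eq}.
HB.instance Definition _ := EqQuotient.on colim.
HB.instance Definition _ := Choice.on colim.

Definition colim_in i (x : R i) : colim := \pi_colim (mk_germ x).

Lemma colim_inP i j (x : R i) (y : R j) :
  colim_in x = colim_in y <->
  exists k (hi : le i k) (hj : le j k), ds_map hi x = ds_map hj y.
Proof.
split=> [/eqmodP/asboolP //|h].
by apply/eqmodP; apply/asboolP.
Qed.

Lemma colim_in_map i j (h : le i j) (x : R i) :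
  colim_in (ds_map h x) = colim_in x.
Proof.
apply/colim_inP; exists j, (ds_refl j), h.
by rewrite ds_map_id.
Qed.

Lemma colim_elim (a : colim) : exists i (x : R i), a = colim_in x.
Proof.
exists (projT1 (repr a)), (projT2 (repr a)).
by rewrite /colim_in -[LHS]reprK; case: (repr a).
Qed.

Lemma colim_elim2 (a b : colim) :
  exists i (x y : R i), a = colim_in x /\ b = colim_in y.
Proof.
have [i [x ->]] := colim_elim a; have [j [y ->]] := colim_elim b.
have [k [ik jk]] := ds_directed i j.
by exists k, (ds_map ik x), (ds_map jk y); rewrite !colim_in_map.
Qed.

Lemma colim_elim3 (a b c : colim) : exists i (x y z : R i),
  [/\ a = colim_in x, b = colim_in y & c = colim_in z].
Proof.
have [i [x [y [-> ->]]]] := colim_elim2 a b; have [j [z ->]] := colim_elim c.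
have [k [ik jk]] := ds_directed i j.
by exists k, (ds_map ik x), (ds_map ik y), (ds_map jk z); rewrite !colim_in_map.
Qed.

Definition colim_bound (a b : germ) : I :=
  projT1 (cid (ds_directed (projT1 a) (projT1 b))).
Definition colim_boundl a b : le (projT1 a) (colim_bound a b) :=
  proj1 (projT2 (cid (ds_directed (projT1 a) (projT1 b)))).
Definition colim_boundr a b : le (projT1 b) (colim_bound a b) :=
  proj2 (projT2 (cid (ds_directed (projT1 a) (projT1 b)))).

Definition colim_op2 (op : forall i, R i -> R i -> R i) (a b : colim) : colim :=
  colim_in (op _ (ds_map (colim_boundl (repr a) (repr b)) (projT2 (repr a)))
                 (ds_map (colim_boundr (repr a) (repr b)) (projT2 (repr b)))).

Definition colim_zero : colim := colim_in (0 : R (ds_idx0 D)).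
Definition colim_one : colim := colim_in (1 : R (ds_idx0 D)).
Definition colim_add := colim_op2 (fun i => +%R).
Definition colim_mul := colim_op2 (fun i => *%R).
Definition colim_opp (a : colim) : colim := colim_in (- projT2 (repr a)).

Lemma germ_repr i (x : R i) :
  exists k (h : le (projT1 (repr (colim_in x))) k) (hi : le i k),
    ds_map h (projT2 (repr (colim_in x))) = ds_map hi x.
Proof.
apply/colim_inP; rewrite -[RHS]reprK /colim_in /mk_germ.
by case: (repr _).
Qed.

Lemma colim_op2E (op : forall i, R i -> R i -> R i) :
  (forall i j (h : le i j) x y,
     ds_map h (op i x y) = op j (ds_map h x) (ds_map h y)) ->
  forall i (x y : R i),
    colim_op2 op (colim_in x) (colim_in y) = colim_in (op i x y).
Proof.
move=> opE i x y; rewrite /colim_op2; set a := repr _; set b := repr _.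
have [k [ha [hi ex]]] := germ_repr x; have [l [hb [hi' ey]]] := germ_repr y.
rewrite -/a -/b in ha hb ex ey *.
have [m [km lm]] := ds_directed k l.
have [n [mn pn]] := ds_directed m (colim_bound a b).
apply/colim_inP; exists n, pn, (ds_trans hi (ds_trans km mn)).
have kn := ds_trans km mn; have ln := ds_trans lm mn.
rewrite !opE; congr op.
  rewrite (ds_map_comp _ _ (ds_trans ha kn)) -(ds_map_comp ha kn) ex.
  by rewrite (ds_map_comp _ _ (ds_trans hi (ds_trans km mn))).
rewrite (ds_map_comp _ _ (ds_trans hb ln)) -(ds_map_comp hb ln) ey.
by rewrite (ds_map_comp _ _ (ds_trans hi (ds_trans km mn))).
Qed.

Lemma colim_addE i (x y : R i) :
  colim_add (colim_in x) (colim_in y) = colim_in (x + y).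
Proof. by apply: colim_op2E => ? ? h ? ?; rewrite rmorphD. Qed.

Lemma colim_mulE i (x y : R i) :
  colim_mul (colim_in x) (colim_in y) = colim_in (x * y).
Proof. by apply: colim_op2E => ? ? h ? ?; rewrite rmorphM. Qed.

Lemma colim_oppE i (x : R i) : colim_opp (colim_in x) = colim_in (- x).
Proof.
have [k [ha [hi ex]]] := germ_repr x.
by apply/colim_inP; exists k, ha, hi; rewrite !rmorphN ex.
Qed.

Lemma colim_zeroE i : colim_zero = colim_in (0 : R i).
Proof.
have [k [h hi]] := ds_directed (ds_idx0 D) i.
by apply/colim_inP; exists k, h, hi; rewrite !rmorph0.
Qed.

Lemma colim_oneE i : colim_one = colim_in (1 : R i).
Proof.
have [k [h hi]] := ds_directed (ds_idx0 D) i.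
by apply/colim_inP; exists k, h, hi; rewrite !rmorph1.
Qed.

Lemma colim_addA : associative colim_add.
Proof.
move=> a b c; have [i [x [y [z [-> -> ->]]]]] := colim_elim3 a b c.
by rewrite !colim_addE addrA.
Qed.
Lemma colim_addC : commutative colim_add.
Proof.
move=> a b; have [i [x [y [-> ->]]]] := colim_elim2 a b.
by rewrite !colim_addE addrC.
Qed.
Lemma colim_add0 : left_id colim_zero colim_add.
Proof.
move=> a; have [i [x ->]] := colim_elim a.
by rewrite (colim_zeroE i) colim_addE add0r.
Qed.
Lemma colim_addN : left_inverse colim_zero colim_opp colim_add.
Proof.
move=> a; have [i [x ->]] := colim_elim a.
by rewrite (colim_zeroE i) colim_oppE colim_addE addNr.
Qed.

HB.instance Definition _ :=
  GRing.isZmodule.Build colim colim_addA colim_addC colim_add0 colim_addN.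

Lemma colim_mulA : associative colim_mul.
Proof.
move=> a b c; have [i [x [y [z [-> -> ->]]]]] := colim_elim3 a b c.
by rewrite !colim_mulE mulrA.
Qed.
Lemma colim_mulC : commutative colim_mul.
Proof.
move=> a b; have [i [x [y [-> ->]]]] := colim_elim2 a b.
by rewrite !colim_mulE mulrC.
Qed.
Lemma colim_mul1 : left_id colim_one colim_mul.
Proof.
move=> a; have [i [x ->]] := colim_elim a.
by rewrite (colim_oneE i) colim_mulE mul1r.
Qed.
Lemma colim_mulDl : left_distributive colim_mul colim_add.
Proof.
move=> a b c; have [i [x [y [z [-> -> ->]]]]] := colim_elim3 a b c.
by rewrite !(colim_addE, colim_mulE) mulrDl.
Qed.

HB.instance Definition _ := GRing.Zmodule_isComPzRing.Build colim
  colim_mulA colim_mulC colim_mul1 colim_mulDl.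

Lemma colim_in_is_zmod_morphism i : zmod_morphism (@colim_in i).
Proof. by move=> x y; rewrite -colim_addE -colim_oppE. Qed.
Lemma colim_in_is_monoid_morphism i : monoid_morphism (@colim_in i).
Proof.
by split=> [|x y]; [exact/esym/colim_oneE | exact/esym/colim_mulE].
Qed.
HB.instance Definition _ i :=
  GRing.isZmodMorphism.Build (R i) colim (@colim_in i)
    (@colim_in_is_zmod_morphism i).
HB.instance Definition _ i :=
  GRing.isMonoidMorphism.Build (R i) colim (@colim_in i)
    (@colim_in_is_monoid_morphism i).

Lemma colim_in_eq0 i (x : R i) :
  colim_in x = 0 <-> exists k (h : le i k), ds_map h x = 0.
Proof.
split=> [|[k [h e]]]; last by rewrite -(colim_in_map h) e rmorph0.
rewrite -(rmorph0 (@colim_in i)) => /colim_inP[k [h [h' e]]].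
by exists k, h; rewrite e rmorph0.
Qed.

End Colimit.

(** The colimits above are only known to be commutative rings; this predicate
    is what it takes to turn one into a [valuationRingType]. *)
Record valuation_domain (R : comPzRingType) : Prop := ValuationDomain {
  vd_neq0 : (1 : R) != 0;
  vd_integral : forall x y : R, x * y = 0 -> x = 0 \/ y = 0;
  vd_total : forall x y : R, (exists z, y = x * z) \/ (exists z, x = y * z)
}.

Lemma frac_numden (A : idomainType) (x : {fraction A}) :
  exists a b : A, b != 0 /\ x = tofrac a / tofrac b.
Proof.
elim/quotW: x => r; exists (\n_r), (\d_r); split; first exact: denom_ratioP.
have d0 : tofrac (\d_r) != 0 by rewrite tofrac_eq0 denom_ratioP.
apply: (mulIf d0); rewrite divfK //.
rewrite /FracField.tofrac; unlock; rewrite -[LHS]FracField.pi_mul.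
apply/eqmodP => /=; rewrite FracField.equivfE /FracField.mulf.
by rewrite !numden_Ratio ?mulf_neq0 ?oner_neq0 ?denom_ratioP // !mulr1 mulrC.
Qed.

Section ValuationRingOf.
Variables (R : comPzRingType) (RP : valuation_domain R).

Definition valuation_ring_of of valuation_domain R : Type := R.
Local Notation W := (valuation_ring_of RP).

HB.instance Definition _ := GRing.ComPzRing.on W.
HB.instance Definition _ :=
  GRing.PzSemiRing_isNonZero.Build W (vd_neq0 RP).

Definition vro_unit : {pred W} := [pred x : W | `[< exists y : W, y * x = 1 >]].
Definition vro_inv (x : W) : W :=
  if pselect (exists y : W, y * x = 1) is left h then projT1 (cid h) else x.

Lemma vro_mulV : {in vro_unit, left_inverse 1 vro_inv *%R}.
Proof.
move=> x; rewrite inE => /asboolP ex; rewrite /vro_inv.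
case: pselect => [h|n]; last by case: n; exact/asboolP.
by case: (cid h).
Qed.
Lemma vro_unitP (x y : W) : y * x = 1 -> vro_unit x.
Proof. by move=> e; apply/asboolP; exists y. Qed.
Lemma vro_inv_out : {in [predC vro_unit], vro_inv =1 id}.
Proof.
move=> x; rewrite inE => /asboolP ex; rewrite /vro_inv.
by case: pselect => // h; case: (ex h).
Qed.

HB.instance Definition _ := GRing.ComNzRing_hasMulInverse.Build W
  vro_mulV vro_unitP vro_inv_out.

Lemma vro_integral (x y : W) : x * y = 0 -> (x == 0) || (y == 0).
Proof. by move=> /(vd_integral RP)[->|->]; rewrite eqxx ?orbT. Qed.

HB.instance Definition _ :=
  GRing.ComUnitRing_isIntegral.Build W vro_integral.

Lemma vro_frac_valuation (x : {fraction W}) : x != 0 ->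
  (exists a : W, x = tofrac a) \/ (exists a : W, x^-1 = tofrac a).
Proof.
move=> _; have [a [b [b0 ->]]] := frac_numden x.
have hE (c d e : W) : d != 0 -> c = d * e -> tofrac c / tofrac d = tofrac e.
  by move=> d0 ->; rewrite rmorphM mulrAC mulfV ?mul1r // tofrac_eq0.
have [-> | a0] := eqVneq a 0; first by left; exists 0; rewrite rmorph0 mul0r.
have [[c e]|[c e]] := vd_total RP a b.
  by right; exists c; rewrite invf_div; apply: hE.
by left; exists c; apply: hE.
Qed.

HB.instance Definition _ :=
  IntegralDomain_isValuationRing.Build W vro_frac_valuation.

End ValuationRingOf.

Lemma valuation_ring_domain (V : valuationRingType) : valuation_domain V.
Proof.
split=> [|x y /eqP|x y]; first exact: oner_neq0.
  by rewrite mulf_eq0 => /orP[]/eqP; [left|right].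
have [->|x0] := eqVneq x 0; first by right; exists 0; rewrite mulr0.
have [->|y0] := eqVneq y 0; first by left; exists 0; rewrite mulr0.
have tx : tofrac x != 0 by rewrite tofrac_eq0.
have ty : tofrac y != 0 by rewrite tofrac_eq0.
have /frac_valuation[[z e]|[z e]] : tofrac x / tofrac y != 0.
- by rewrite mulf_neq0 ?invr_eq0.
- right; exists z; apply/eqP; rewrite -tofrac_eq tofracM -e mulrC.
  by rewrite divfK.
- left; exists z; apply/eqP; rewrite -tofrac_eq tofracM -e invf_div mulrC.
  by rewrite divfK.
Qed.

Section Ultrapower.
Variables (U : Type) (F : set_system U) (FU : UltraFilter F).

(** The ultrapower is the colimit of the products [sval A -> C] over [A] in [F]
    ordered by reverse inclusion, with the restrictions as transition maps. *)
Definition ultra_idx := {A : set U | F A}.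
Definition ultra_le (A B : ultra_idx) : Prop := sval B `<=` sval A.

Lemma ultra_refl A : ultra_le A A.
Proof. exact: subset_refl. Qed.
Lemma ultra_trans A B C : ultra_le A B -> ultra_le B C -> ultra_le A C.
Proof. by move=> AB BC; apply: subset_trans AB. Qed.
Definition ultra_setT : ultra_idx := exist _ setT filterT.
Lemma ultra_directed A B : exists C, ultra_le A C /\ ultra_le B C.
Proof.
by exists (exist _ _ (filterI (svalP A) (svalP B))); split => u [].
Qed.

Section Restriction.
Variables (C : comPzRingType) (A B : ultra_idx) (AB : ultra_le A B).

Definition restriction (f : sval A -> C) : sval B -> C := f \o subfun AB.
Lemma restriction_is_zmod_morphism : zmod_morphism restriction.
Proof. by []. Qed.
Lemma restriction_is_monoid_morphism : monoid_morphism restriction.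
Proof. by []. Qed.
HB.instance Definition _ :=
  GRing.isZmodMorphism.Build (sval A -> C) (sval B -> C) restriction
    restriction_is_zmod_morphism.
HB.instance Definition _ :=
  GRing.isMonoidMorphism.Build (sval A -> C) (sval B -> C) restriction
    restriction_is_monoid_morphism.
End Restriction.

Section UltrapowerRing.
Variable C : comPzRingType.

Lemma restriction_id A (h : ultra_le A A) (f : sval A -> C) :
  restriction h f = f.
Proof. by apply/funext => u; congr f; apply: val_inj. Qed.
Lemma restriction_comp A B E (AB : ultra_le A B) (BE : ultra_le B E)
    (AE : ultra_le A E) (f : sval A -> C) :
  restriction BE (restriction AB f) = restriction AE f.
Proof. by apply/funext => u; congr f; apply: val_inj. Qed.

Definition ultra_system := @DirectedSystem ultra_idx ultra_le ultra_setT
  ultra_refl ultra_trans ultra_directed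
  (fun A => sval A -> C : comPzRingType)
  (fun A B AB => restriction AB : {rmorphism (sval A -> C) -> (sval B -> C)})
  restriction_id restriction_comp.

Definition ultrapower_ring : comPzRingType := colim ultra_system.

Definition ultra_in (f : U -> C) : ultrapower_ring :=
  @colim_in ultra_system ultra_setT (fun u => f (val u)).

Lemma ultra_in_is_zmod_morphism : zmod_morphism ultra_in.
Proof.
move=> f g; rewrite /ultra_in.
by rewrite -[RHS](rmorphB (@colim_in ultra_system ultra_setT)).
Qed.
Lemma ultra_in_is_monoid_morphism : monoid_morphism ultra_in.
Proof.
split=> [|f g]; rewrite /ultra_in.
  by rewrite -[RHS](rmorph1 (@colim_in ultra_system ultra_setT)).
by rewrite -[RHS](rmorphM (@colim_in ultra_system ultra_setT)).
Qed.
HB.instance Definition _ :=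
  GRing.isZmodMorphism.Build (U -> C) ultrapower_ring ultra_in
    ultra_in_is_zmod_morphism.
HB.instance Definition _ :=
  GRing.isMonoidMorphism.Build (U -> C) ultrapower_ring ultra_in
    ultra_in_is_monoid_morphism.

Lemma ultra_in_elim (a : ultrapower_ring) : exists f, a = ultra_in f.
Proof.
have [A0 [f0 ->]] := colim_elim a.
pose A : ultra_idx := A0; pose f : sval A -> C := f0.
rewrite -/f -[A0]/A; clearbody f; clear f0.
pose g u : C := if pselect (u \in sval A) is left h then f (exist _ u h) else 0.
exists g; apply/colim_inP.
have AT : ultra_le ultra_setT A by [].
exists A, (@ultra_refl A), AT; apply/funext => u /=.
rewrite /restriction /= /g /=; case: pselect => [h|]; last first.
  by case; apply: (valP u).
by congr f; apply: val_inj.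
Qed.

Lemma ultra_inP (f g : U -> C) :
  ultra_in f = ultra_in g <-> F [set u | f u = g u].
Proof.
split=> [/colim_inP[A [h [h' e]]]|FA].
  apply: filterS (svalP A) => u Au.
  by have /= := congr1 (fun k => k (exist _ u (mem_set Au))) e.
apply/colim_inP; pose A : ultra_idx := exist _ _ FA.
have AT : ultra_le ultra_setT A by [].
exists A, AT, AT; apply/funext => u /=.
by have := set_mem (valP u).
Qed.

Lemma ultrapower_valuation_domain :
  valuation_domain C -> valuation_domain ultrapower_ring.
Proof.
move=> CP; split=> [|a b|a b].
- apply/eqP; rewrite -(rmorph1 ultra_in) -(rmorph0 ultra_in) => /ultra_inP FA.
  have [u /= e] := filter_ex FA.
  by have := vd_neq0 CP; rewrite [1]e eqxx.
- have [f ->] := ultra_in_elim a; have [g ->] := ultra_in_elim b.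
  rewrite -rmorphM -(rmorph0 ultra_in) => /ultra_inP FA.
  have [Ff|Ff] := in_ultra_setVsetC [set u | f u = 0] FU.
    by left; apply/ultra_inP.
  right; apply/ultra_inP; apply: filterS (filterI FA Ff) => u /= [fg f0].
  by have [//|] := vd_integral CP fg.
have [f ->] := ultra_in_elim a; have [g ->] := ultra_in_elim b.
have [Ff|Ff] := in_ultra_setVsetC [set u | exists z, g u = f u * z] FU.
  left; pose z u : C :=
    if pselect (exists z, g u = f u * z) is left h then projT1 (cid h) else 0.
  exists (ultra_in z); rewrite -rmorphM; apply/ultra_inP.
  apply: filterS Ff => u /= h; rewrite /z /GRing.mul /=.
  by case: pselect => // h'; case: (cid h').
right; pose z u : C :=
  if pselect (exists z, f u = g u * z) is left h then projT1 (cid h) else 0.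
exists (ultra_in z); rewrite -rmorphM; apply/ultra_inP.
apply: filterS Ff => u /= h; rewrite /z /GRing.mul /=.
case: pselect => [h'|[]]; first by case: (cid h').
by have [] := vd_total CP (f u) (g u).
Qed.

Definition diag_embedding (c : C) : ultrapower_ring := ultra_in (fun=> c).

Lemma diag_embedding_is_zmod_morphism : zmod_morphism diag_embedding.
Proof. by move=> c d; rewrite /diag_embedding -rmorphB. Qed.
Lemma diag_embedding_is_monoid_morphism : monoid_morphism diag_embedding.
Proof.
split=> [|c d]; rewrite /diag_embedding; first by rewrite -[RHS](rmorph1 ultra_in).
by rewrite -rmorphM.
Qed.
HB.instance Definition _ :=
  GRing.isZmodMorphism.Build C ultrapower_ring diag_embedding
    diag_embedding_is_zmod_morphism.
HB.instance Definition _ :=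
  GRing.isMonoidMorphism.Build C ultrapower_ring diag_embedding
    diag_embedding_is_monoid_morphism.

End UltrapowerRing.

Definition ultrapower (V : valuationRingType) : valuationRingType :=
  valuation_ring_of
    (ultrapower_valuation_domain (valuation_ring_domain V)).

End Ultrapower.

(** [transition f n m] is the composite [R n -> R n.+1 -> ... -> R m]. Shifting
    the sequence when both indices are successors avoids casts along equalities
    of indices. *)
Fixpoint transition (R : nat -> comPzRingType)
    (f : forall n, {rmorphism R n -> R n.+1}) (n m : nat) {struct m} :
    (n <= m)%N -> {rmorphism R n -> R m} :=
  match m, n with
  | 0, 0 => fun=> idfun
  | m'.+1, 0 => fun=> f m' \o transition f (leq0n m')
  | 0, n'.+1 => fun h => False_rect _ (notF h)
  | m'.+1, n'.+1 =>
      fun h => @transition (fun k => R k.+1) (fun k => f k.+1) n' m' h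
  end.

Section Sequence.
Variables (R : nat -> comPzRingType) (f : forall n, {rmorphism R n -> R n.+1}).

Lemma transition_id n (h : (n <= n)%N) x : transition f h x = x.
Proof. by elim: n R f h x => [|n IH] R' f' h x //=; apply: IH. Qed.

Lemma transitionS n m (h : (n <= m)%N) (h' : (n <= m.+1)%N) x :
  transition f h' x = f m (transition f h x).
Proof.
elim: n m R f h h' x => [|n IH] [|m] R' f' h h' x //.
exact: (IH m (fun k => R' k.+1) (fun k => f' k.+1)).
Qed.

Lemma transition_comp n m k (nm : (n <= m)%N) (mk : (m <= k)%N)
    (nk : (n <= k)%N) x :
  transition f mk (transition f nm x) = transition f nk x.
Proof.
elim: k mk nk => [|k IH] mk nk.
  have m0 : m = 0%N by apply/eqP; rewrite -leqn0.
  subst m.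
  by rewrite transition_id (bool_irrelevance nm nk).
have [e|/negP mk'] := eqVneq m k.+1; last first.
  have {}mk' : (m <= k)%N by rewrite -ltnS ltn_neqAle mk andbT; apply/negP.
  have nk' := leq_trans nm mk'.
  by rewrite (transitionS mk') (transitionS nk') (IH mk' nk').
by subst m; rewrite transition_id (bool_irrelevance nm nk).
Qed.

Lemma leq_directed n m : exists k, (n <= k)%N /\ (m <= k)%N.
Proof. by exists (maxn n m); rewrite leq_maxl leq_maxr. Qed.

Definition seq_system := @DirectedSystem nat (fun n m => n <= m)%N 0%N
  leqnn (fun i j k => @leq_trans j i k) leq_directed R (@transition R f)
  transition_id transition_comp.

Lemma seq_colim_valuation_domain :
  (forall n, valuation_domain (R n)) -> valuation_domain (colim seq_system).
Proof.
move=> RP; split=> [|a b|a b].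
- apply/eqP; rewrite -(rmorph1 (@colim_in seq_system 0%N)).
  move=> /colim_in_eq0[k [h e]]; have := vd_neq0 (RP k).
  by rewrite -e rmorph1 eqxx.
- have [i [x [y [-> ->]]]] := colim_elim2 a b.
  rewrite -rmorphM => /colim_in_eq0[k [h]].
  rewrite rmorphM => /(vd_integral (RP k))[e|e]; [left|right];
    by apply/colim_in_eq0; exists k, h.
have [i [x [y [-> ->]]]] := colim_elim2 a b.
have [[z ->]|[z ->]] := vd_total (RP i) x y; [left|right];
  by exists (@colim_in seq_system i z); rewrite rmorphM.
Qed.

End Sequence.

Section Tower.
Variables (V : valuationRingType) (U : nat -> Type).
Variables (F : forall n, set_system (U n)) (FU : forall n, UltraFilter (@F n)).

(** Ultrafilters are indexed from [0]: [F n] is used to build stage [n.+1]. *)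
Fixpoint tower (n : nat) : valuationRingType :=
  if n is n'.+1 then ultrapower (FU n') (tower n') else V.

Definition tower_system : directed_system :=
  seq_system (R := tower) (fun n => diag_embedding (FU n) (C := tower n)).

Definition tower_colim : valuationRingType :=
  valuation_ring_of (seq_colim_valuation_domain
    (fun n => diag_embedding (FU n) (C := tower n))
    (fun n => valuation_ring_domain (tower n))).

End Tower.

(* Main.v *)
Require Import Defs.
From HB Require Import structures.
From mathcomp Require Import all_boot all_order all_algebra.
From mathcomp Require Import boolp classical_sets functions filter.

Set Implicit Arguments.
Unset Strict Implicit.
Unset Printing Implicit Defensive.

Import GRing.Theory.
Local Open Scope classical_set_scope.
Local Open Scope ring_scope.

(** A cross-section [s] of a valuation ring with fraction field [K] amounts to
    a retraction [f] of [K^*] onto the group of units, by [s (val x) = x / f x].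
    Write [K_n] for the fraction field of [V_n]. Suppose that such an [f] is given
    on a subgroup [B] of [K_n^*] with [K_n^* / B] torsion-free. Any finitely
    generated extension of [B] is [B] plus a free group, so [f] extends to it. If
    the ultrafilter on the finite subsets of [V_n] contains every
    [{X | x \in X}], these extensions assemble to a morphism from [K_n^*] to the
    units of [V_(n+1)], which together with the identity on these units is a
    retraction on the subgroup [B'] of [K_(n+1)^*] generated by [K_n^*] and the
    units. The quotient [K_(n+1)^* / B'] is again torsion-free, because the value
    group of [V_n] is pure in that of its ultrapower. In the colimit these
    retractions are defined everywhere. *)

(** * Retractions onto a pure subgroup, additive on a finite set *)

Section PureSubgroup.
Variables (A : zmodType) (B : A -> Prop).
Hypotheses (B0 : B 0) (BB : forall x y, B x -> B y -> B (x - y)).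
Hypothesis B_pure : forall x k, B (x *+ k.+1) -> B x.

Let spanned r (Y : 'I_r -> A) x :=
  exists b (c : 'rV[int]_r), B b /\ x = b + \sum_j Y j *~ c 0 j.

Let BN x : B x -> B (- x).
Proof. by rewrite -[- x]sub0r; apply: BB. Qed.

Let BD x y : B x -> B y -> B (x + y).
Proof. by move=> Bx /BN By; rewrite -[y]opprK; apply: BB. Qed.

Let BMz x (k : int) : B x -> B (x *~ k).
Proof.
move=> Bx; have Bn n : B (x *+ n).
  by elim: n => [//|n IH]; rewrite mulrSr; apply: BD.
by case: k => n; [exact: Bn|rewrite NegzE mulrNz; apply/BN/Bn].
Qed.

Let BMz_inv x (k : int) : k != 0 -> B (x *~ k) -> B x.
Proof.
case: k => [[//|k]|k] _; first exact: B_pure.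
by rewrite NegzE mulrNz => /BN; rewrite opprK; apply: B_pure.
Qed.

(* A relation among [r.+1] generators becomes, after the unimodular change of
   generators given by its Smith normal form, a relation [d * y0 = 0] modulo
   [B], so that [y0] is in [B] and can be dropped. *)
Lemma spanned_drop r (Y : 'I_r.+1 -> A) (c : 'rV[int]_r.+1) :
    c != 0 -> B (\sum_j Y j *~ c 0 j) ->
  exists Z : 'I_r -> A, forall x, spanned Y x -> spanned Z x.
Proof.
move=> c0 Bc.
have [L _ [R uR [d _ cE]]] := int_Smith_normal_form c.
pose Y' i := \sum_j Y j *~ R i j.
have sumE (e : 'rV[int]_r.+1) :
    \sum_j Y j *~ (e *m R) 0 j = \sum_i Y' i *~ e 0 i.
  under eq_bigr do rewrite mxE mulrz_sumr.
  rewrite exchange_big; apply: eq_bigr => i _ /=; rewrite mulrz_suml.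
  by apply: eq_bigr => j _; rewrite mulrC mulrzA.
pose e := L *m (\matrix_(i, j) (d`_i *+ (i == j :> nat))) : 'rV[int]_r.+1.
have e_lift i : e 0 (lift ord0 i) = 0.
  by rewrite /e mxE big_ord1 mxE /= mulr0.
have e0 : e 0 0 != 0.
  apply: contraNneq c0 => e0; rewrite cE -/e.
  suff -> : e = 0 by rewrite mul0mx.
  apply/rowP => j; rewrite [RHS]mxE.
  by case: (unliftP ord0 j) => [i ->|->]; rewrite ?e_lift.
have BY0 : B (Y' 0).
  apply: (BMz_inv e0); move: Bc; rewrite cE -/e sumE big_ord_recl big1 ?addr0 //.
  by move=> i _; rewrite e_lift mulr0z.
exists (fun i => Y' (lift ord0 i)) => x [b [c' [Bb ->]]].
pose e' := c' *m invmx R.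
exists (b + Y' 0 *~ e' 0 0), (\row_i e' 0 (lift ord0 i)); split.
  by apply: BD => //; apply: BMz.
rewrite -(mulmxKV uR c') sumE big_ord_recl addrA; congr (_ + _).
by apply: eq_bigr => i _; rewrite [in RHS]mxE.
Qed.

(** A family [Y] of least size that spans [X] modulo [B] is free modulo [B], since [spanned_drop]
    would shorten it along any nontrivial relation. Hence [B] and [Y] span a direct sum containing
    [X], and [p] is the projection of this sum onto [B]. *)
Lemma pure_retraction (X : seq A) : exists p : A -> A,
  [/\ forall x, B (p x), forall x, B x -> p x = x &
      {in X &, {morph p : x y / x + y}}].
Proof.
have ex_span : exists r, `[< exists Y : 'I_r -> A, {in X, forall x, spanned Y x} >].
  exists (size X); apply/asboolP; exists (fun i => X`_i) => x /(nthP 0)[i iX <-].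
  exists 0, (delta_mx 0 (Ordinal iX)); split=> //; rewrite add0r.
  rewrite (bigD1 (Ordinal iX)) //= mxE !eqxx mulr1z big1 ?addr0 // => j jn.
  by rewrite mxE (negPf jn) andbF mulr0z.
case: (ex_minnP ex_span) => r /asboolP[Y spY] r_min.
have freeY (c : 'rV[int]_r) : B (\sum_j Y j *~ c 0 j) -> c = 0.
  case: r Y c spY r_min => [|r] Y c spY r_min Bc.
    by apply/rowP => -[].
  apply/eqP/contraT => c0; have [Z spZ] := spanned_drop c0 Bc.
  suff /r_min : `[< exists Z : 'I_r -> A, {in X, forall x, spanned Z x} >].
    by rewrite ltnn.
  by apply/asboolP; exists Z => x /spY/spZ.
have uniq_b b b' (c c' : 'rV[int]_r) : B b -> B b' ->
    b + \sum_j Y j *~ c 0 j = b' + \sum_j Y j *~ c' 0 j -> b = b'.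
  move=> Bb Bb' e; suff cc : c = c' by move: e; rewrite cc => /addIr.
  apply/eqP; rewrite -subr_eq0; apply/eqP/freeY.
  have <- : b' - b = \sum_j Y j *~ (c - c') 0 j; last exact: BB.
  under eq_bigr do rewrite !mxE mulrzBr; rewrite sumrB.
  by apply/eqP; rewrite subr_eq addrAC eq_sym subr_eq addrC eq_sym e addrC.
(* Outside the span the default [0] keeps [p] valued in [B]. *)
pose p x := if pselect (spanned Y x) is left h then projT1 (cid h) else 0.
have pE b c : B b -> p (b + \sum_j Y j *~ (c : 'rV[int]_r) 0 j) = b.
  move=> Bb; rewrite /p; case: pselect => [h|[]]; last by exists b, c.
  by case: (cid h) => b' /= [c' [Bb' e]]; apply/esym/(uniq_b _ _ c c').
exists p; split=> [x|x Bx|x y /spY[b [c [Bb ->]]] /spY[b' [c' [Bb' ->]]]].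
- by rewrite /p; case: pselect => // h; case: (cid h) => b [c []].
- rewrite -[x in LHS]addr0 -[0](_ : \sum_j Y j *~ (0 : 'rV[int]_r) 0 j = 0) ?pE //.
  by rewrite big1 // => j _; rewrite mxE mulr0z.
rewrite !pE // addrACA -big_split /=.
under eq_bigr do rewrite -mulrzDr.
have -> : \sum_i Y i *~ (c 0 i + c' 0 i) = \sum_i Y i *~ (c + c') 0 i.
  by apply: eq_bigr => i _; rewrite mxE.
by rewrite pE //; apply: BD.
Qed.

End PureSubgroup.

(** * Fine ultrafilters on finite sequences *)

(** Sequences stand for finite subsets. The families containing all supersets of some [s0] form a
    filter, by concatenation, and it is proper because [s0] belongs to such a family. *)
Lemma fine_ultrafilter (T : eqType) : exists F : set_system (seq T),
  UltraFilter F /\ forall x, F [set s : seq T | x \in s].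
Proof.
pose F0 : set_system (seq T) :=
  [set P | exists s0 : seq T, forall s, {subset s0 <= s} -> P s].
have F0P : ProperFilter F0.
  apply: Build_ProperFilter_ex => [P [s0 Ps0]|]; first by exists s0; apply: Ps0.
  split=> [|P Q [s Ps] [t Qt]|P Q PQ [s Ps]]; first by exists [::].
    exists (s ++ t) => r str; split; [apply: Ps|apply: Qt] => x xs;
      by apply: str; rewrite mem_cat xs ?orbT.
  by exists s => t /Ps/PQ.
have [F [FU F0F]] := ultraFilterLemma F0P; exists F; split=> // x.
by apply: F0F; exists [:: x] => s; apply; rewrite mem_head.
Qed.

(** * The multiplicative group of a field as a Z-module *)

Section MultiplicativeGroup.
Variable K : fieldType.

(* The group [K^*] in additive notation, so that the library of Z-modules
   applies to it. *)
Definition nonzero_add : Type := nonzero K.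
HB.instance Definition _ := Choice.on nonzero_add.

Let nz_mulC : commutative (@nz_mul K).
Proof. by move=> x y; apply: val_inj; rewrite /= mulrC. Qed.

HB.instance Definition _ := GRing.isZmodule.Build nonzero_add
  (@nz_mulA K) nz_mulC (@nz_mul1 K) (@nz_mulV K).

Lemma nz_valD (x y : nonzero_add) : nz_val (x + y) = nz_val x * nz_val y.
Proof. by []. Qed.

Lemma nz_valMn (x : nonzero_add) n : nz_val (x *+ n) = nz_val x ^+ n.
Proof. by elim: n => // n IH; rewrite mulrS exprS nz_valD IH. Qed.

End MultiplicativeGroup.

(** * Partial retractions onto the units *)

(* [f] is a retraction onto the units defined on a subgroup of the
   multiplicative group of the fraction field of [W] that contains the units and
   whose quotient is torsion-free; the subgroup is represented by its trace [B]
   on [W]. The associated partial cross-section maps the value of [x] to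
   [x / f x]. *)
Record unit_retraction (W : valuationRingType) (B : W -> Prop) (f : W -> W)
    : Prop := UnitRetraction {
  ur_neq0 : forall x, B x -> x != 0;
  ur_unit : forall x, x \is a GRing.unit -> B x;
  ur_mul : forall x y, B x -> B y -> B (x * y);
  ur_div : forall x y, B x -> B (x * y) -> B y;
  ur_root : forall x k, B (x ^+ k.+1) -> B x;
  ur_fU : forall x, B x -> f x \is a GRing.unit;
  ur_fM : forall x y, B x -> B y -> f (x * y) = f x * f y;
  ur_fid : forall x, x \is a GRing.unit -> f x = x
}.

Section ValuationRing.
Variable W : valuationRingType.
Implicit Types x y : W.

(** Torsion-freeness of the value group: one of [x], [y] divides the other, and a power of the
    quotient is a unit, hence so is the quotient. *)
Lemma associate_of_pow x y u k : y != 0 -> u \is a GRing.unit ->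
  x ^+ k.+1 = y ^+ k.+1 * u -> exists2 w, w \is a GRing.unit & x = y * w.
Proof.
move=> y0 uU e; have [[z xE]|[z yE]] := vd_total (valuation_ring_domain W) y x.
  exists z => //; rewrite -(unitrX_pos _ (ltn0Sn k)).
  move: e; rewrite xE exprMn => /mulfI ->//; exact: expf_neq0.
have x0 : x != 0 by apply: contraNneq y0; rewrite yE => ->; rewrite mul0r.
have zU : z \is a GRing.unit.
  rewrite -(unitrX_pos _ (ltn0Sn k)); apply/unitrPr; exists u.
  apply: (mulfI (expf_neq0 k.+1 x0)).
  by rewrite mulrA -exprMn -yE -e mulr1.
by exists z^-1; rewrite ?unitrV // yE mulrK.
Qed.

(** The starting point of the induction on stages. *)
Lemma units_retraction :
  unit_retraction (fun x => x \is a GRing.unit) (@id W).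
Proof.
split=> //.
- by move=> x; apply: contraTneq => ->; rewrite unitr0.
- by move=> x y xU yU; rewrite unitrM xU.
- by move=> x y xU; rewrite unitrM xU.
- by move=> x k; rewrite unitrX_pos.
Qed.

End ValuationRing.

(** * Extension of a partial retraction to fractions *)

Section RetractionOnFractions.
Variables (W : valuationRingType) (B : W -> Prop) (f : W -> W).
Hypothesis Bf : unit_retraction B f.
Local Notation K := {fraction W}.

(** The subgroup of quotients of elements of [B]; by [ur_div] its trace on [W] is [B]. *)
Definition frac_dom (x : nonzero K) :=
  exists a b, [/\ B a, B b & nz_val x * tofrac b = tofrac a].

(** The default [1] makes the value a unit outside [frac_dom] too. *)
Definition frac_retraction (x : nonzero K) : W :=
  xget 1 [set z | exists a b,
    [/\ B a, B b, nz_val x * tofrac b = tofrac a & z = f a / f b]].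

Lemma frac_retraction_unit x : frac_retraction x \is a GRing.unit.
Proof.
rewrite /frac_retraction.
case: xgetP => [z _ [a [b [Ba Bb _ ->]]]|_];
  last exact: unitr1.
by rewrite unitrM unitrV (ur_fU Bf Ba) (ur_fU Bf Bb).
Qed.

Lemma frac_retractionE x a b : B a -> B b ->
  nz_val x * tofrac b = tofrac a -> frac_retraction x = f a / f b.
Proof.
move=> Ba Bb e; rewrite /frac_retraction.
case: xgetP => [_ _ [a' [b' [Ba' Bb' e' ->]]]|/(_ (f a / f b))[]];
  last by exists a, b.
have abE : a' * b = a * b'.
  apply/eqP; rewrite -tofrac_eq !tofracM -e -e'; apply/eqP.
  by rewrite mulrAC.
have fU := ur_fU Bf.
apply: (mulIr (fU _ Bb)); rewrite divrK ?fU //.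
apply: (mulIr (fU _ Bb')); rewrite mulrAC divrK ?fU //.
by rewrite -!(ur_fM Bf) // abE.
Qed.

Lemma frac_domM x y : frac_dom x -> frac_dom y -> frac_dom (x * y)%g.
Proof.
move=> [a [b [Ba Bb e]]] [a' [b' [Ba' Bb' e']]].
exists (a * a'), (b * b'); split; try exact: ur_mul Bf _ _ _ _.
by rewrite !tofracM nz_valM mulrACA e e'.
Qed.

Lemma frac_domV x : frac_dom x -> frac_dom x^-1%g.
Proof.
move=> [a [b [Ba Bb e]]]; exists b, a; split=> //.
by rewrite -e /= mulKf // nz_neq0.
Qed.

(** Either [x] or its inverse lies in [W], where [ur_root] and [ur_div] apply. *)
Lemma frac_dom_root (x : nonzero_add K) k : frac_dom (x *+ k.+1) -> frac_dom x.
Proof.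
have B1 : B 1 by apply: (ur_unit Bf); apply: unitr1.
have key (y : nonzero_add K) c :
    nz_val y = tofrac c -> frac_dom (y *+ k.+1) -> frac_dom y.
  move=> yE [a [b [Ba Bb]]]; rewrite nz_valMn yE -tofracXn -tofracM => /eqP.
  rewrite tofrac_eq => /eqP e; exists c, 1; split=> //;
    last by rewrite tofrac1 mulr1.
  by apply: (ur_root Bf (k := k)); apply: (ur_div Bf Bb); rewrite mulrC e.
have [[c e]|[c e]] := frac_valuation _ (nz_neq0 x); first exact: key e.
move=> dx; rewrite -[x]opprK; apply: frac_domV; apply: (key (- x) c e).
by rewrite mulNrn; apply: frac_domV.
Qed.

Lemma frac_retractionM x y : frac_dom x -> frac_dom y ->
  frac_retraction (x * y)%g = frac_retraction x * frac_retraction y.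
Proof.
move=> [a [b [Ba Bb e]]] [a' [b' [Ba' Bb' e']]].
have BM := ur_mul Bf.
rewrite (frac_retractionE Ba Bb e) (frac_retractionE Ba' Bb' e').
rewrite (@frac_retractionE _ (a * a') (b * b')); first last.
- by rewrite !tofracM nz_valM mulrACA e e'.
- exact: BM.
- exact: BM.
rewrite (ur_fM Bf Ba Ba') (ur_fM Bf Bb Bb') [RHS]mulrACA invrM.
- by rewrite [in RHS](mulrC (f b)^-1).
- exact: (ur_fU Bf).
- exact: (ur_fU Bf).
Qed.

(** By [frac_dom_root] the subgroup [frac_dom] is pure, so [pure_retraction] gives a projection [p]
    onto it; [g] is [p] followed by [frac_retraction]. *)
Lemma finite_unit_morphism (X : seq W) : exists g : W -> W,
  [/\ forall x, g x \is a GRing.unit, forall x, B x -> g x = f x &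
      {in X &, forall x y, x != 0 -> y != 0 -> g (x * y) = g x * g y}].
Proof.
pose toA (x : W) : nonzero_add K := insubd (nz_one K) (tofrac x).
have toAE x : x != 0 -> nz_val (toA x) = tofrac x.
  by move=> x0; rewrite /toA -[nz_val _]/(val _) insubdK ?unfold_in ?tofrac_eq0.
have B1 : B 1 by apply: (ur_unit Bf); apply: unitr1.
have dom0 : frac_dom (0 : nonzero_add K).
  by exists 1, 1; split=> //; rewrite tofrac1 mulr1.
have domB (x y : nonzero_add K) : frac_dom x -> frac_dom y -> frac_dom (x - y).
  by move=> dx /frac_domV; apply: frac_domM.
have [p [pB p_id pD]] := pure_retraction dom0 domB frac_dom_root (map toA X).
exists (fun x => frac_retraction (p (toA x))); split=> [x|x Bx|x y xX yX x0 y0].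
- exact: frac_retraction_unit.
- have e : nz_val (toA x) * tofrac 1 = tofrac x.
    by rewrite tofrac1 mulr1 toAE // (ur_neq0 Bf).
  rewrite p_id; last by exists x, 1.
  by rewrite (frac_retractionE Bx B1 e) (ur_fid Bf (unitr1 W)) divr1.
rewrite -frac_retractionM // -[(p _ * p _)%g]/(p (toA x) + p (toA y)).
rewrite -pD ?map_f //; congr (frac_retraction (p _)).
by apply: val_inj; rewrite /= !toAE ?mulf_neq0 // tofracM.
Qed.

End RetractionOnFractions.

(** * Passage from a valuation ring to its ultrapower *)

Section UltrapowerStep.
Variables (W : valuationRingType) (U : Type) (F : set_system U).
Variable FU : UltraFilter F.
Local Notation W' := (ultrapower FU W).

Let diag : {rmorphism W -> W'} := diag_embedding FU (C := W).
Let cls (h : U -> W) : W' := ultra_in FU h.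

Let cls_elim (x : W') : exists h, x = cls h.
Proof. exact: ultra_in_elim. Qed.

Let clsP (h k : U -> W) : cls h = cls k <-> F [set i | h i = k i].
Proof. exact: ultra_inP. Qed.

Let clsM (h k : U -> W) : cls h * cls k = cls (fun i => h i * k i).
Proof. exact/esym/(rmorphM (ultra_in FU (C := W))). Qed.

Let cls0 : 0 = cls (fun=> 0).
Proof. exact/esym/(rmorph0 (ultra_in FU (C := W))). Qed.

Let cls1 : 1 = cls (fun=> 1).
Proof. exact/esym/(rmorph1 (ultra_in FU (C := W))). Qed.

Let clsX (h : U -> W) n : cls h ^+ n = cls (fun i => h i ^+ n).
Proof.
elim: n => // n IH; rewrite exprS IH clsM; congr cls.
by apply/funext => i; rewrite exprS.
Qed.

Let cls_unit (h : U -> W) :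
  cls h \is a GRing.unit <-> F [set i | h i \is a GRing.unit].
Proof.
split=> [/unitrPr[y]|Fh].
  have [k ->] := cls_elim y; rewrite clsM cls1 => /clsP Fhk.
  by apply: filterS Fhk => i /= e; apply/unitrPr; exists (k i).
apply/unitrPr; exists (cls (fun i => (h i)^-1)); rewrite clsM cls1; apply/clsP.
by apply: filterS Fh => i /= hU; rewrite mulrV.
Qed.

Let diag_eq0 a : diag a = 0 -> a = 0.
Proof.
by rewrite cls0 => /(clsP (fun=> a)) /filter_ex[].
Qed.

(** The equation holds at almost every index; a single index where [v] is also a unit gives the
    divisibility in [W]. *)
Let diag_dvd a b x v : v \is a GRing.unit -> diag a * x = diag b * v ->
  exists c, b = a * c.
Proof.
have [h ->] := cls_elim x; have [k ->] := cls_elim v => /cls_unit kU.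
rewrite [diag a]/(cls (fun=> a)) [diag b]/(cls (fun=> b)) !clsM => /clsP e.
have [i [/= ki ei]] := filter_ex (filterI kU e).
by exists (h i * (k i)^-1); rewrite mulrA ei mulrK.
Qed.

Variables (B : W -> Prop) (f : W -> W) (Bf : unit_retraction B f).
Variables (m : U -> seq W) (m_fine : forall x, F [set i | x \in m i]).

Let g i := projT1 (cid (finite_unit_morphism Bf (m i))).
Let gU i x : g i x \is a GRing.unit.
Proof. by rewrite /g; case: cid => ? []. Qed.
Let g_ext i x : B x -> g i x = f x.
Proof. by rewrite /g; case: cid => ? [? h ?] /h. Qed.
Let gM i : {in m i &, forall x y, x != 0 -> y != 0 -> g i (x * y) = g i x * g i y}.
Proof. by rewrite /g; case: cid => ? []. Qed.

Let rho x : W' := cls (g ^~ x).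

Let rhoU x : rho x \is a GRing.unit.
Proof. by apply/cls_unit; apply: filterE => i; apply: gU. Qed.

Let rho_ext x : B x -> rho x = diag (f x).
Proof. by move=> Bx; congr cls; apply/funext => i; apply: g_ext. Qed.

(** Each [g i] is multiplicative only on [m i], but by [m_fine] two given elements lie in [m i] for
    almost all [i]. *)
Let rhoM x y : x != 0 -> y != 0 -> rho (x * y) = rho x * rho y.
Proof.
move=> x0 y0; rewrite clsM; apply/clsP.
by apply: filterS (filterI (m_fine x) (m_fine y)) => i [xm ym]; apply: gM.
Qed.

Let rho_unit x : x \is a GRing.unit -> rho x = diag x.
Proof. by move=> xU; rewrite rho_ext ?(ur_fid Bf) //; apply: (ur_unit Bf). Qed.

(** By [diag_dvd], quotients of such products that lie in [W'] are again of this form. *)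
Let B' (x : W') := exists a u, [/\ a != 0, u \is a GRing.unit & x = diag a * u].
Let f' (x : W') := xget 1 [set z | exists a u,
  [/\ a != 0, u \is a GRing.unit, x = diag a * u & z = rho a * u]].

(** If [diag a * u = diag b * v], then [b = a * c] with [c] a unit of [W], and [rho] agrees with
    [diag] on such [c]; so the presentation does not matter. *)
Let f'E a u : a != 0 -> u \is a GRing.unit -> f' (diag a * u) = rho a * u.
Proof.
move=> a0 uU; rewrite /f'.
case: xgetP => [_ _ [b [v [b0 vU e ->]]]|/(_ (rho a * u))[]]; last by exists a, u.
have [c bE] := diag_dvd vU e.
have c0 : c != 0 by apply: contraNneq b0; rewrite bE => ->; rewrite mulr0.
have da0 : diag a != 0 by apply: contraNneq a0 => /diag_eq0 ->.
have uE : u = diag c * v.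
  by apply: (mulfI da0); rewrite e bE rmorphM mulrA.
have cU : c \is a GRing.unit.
  have : diag c \is a GRing.unit by move: uU; rewrite uE unitrMl.
  by move=> /(cls_unit (fun=> c)) /filter_ex[].
by rewrite bE rhoM // uE (rho_unit cU) mulrA.
Qed.

(** The new domain contains all nonzero elements of [W], which makes the retraction total in the
    colimit. *)
Lemma ultrapower_step : exists (B' : W' -> Prop) (f' : W' -> W'),
  unit_retraction B' f' /\
  forall a, a != 0 -> B' (diag a) /\ (B a -> f' (diag a) = diag (f a)).
Proof.
have diag_neq0 a : a != 0 -> diag a != 0.
  by move=> a0; apply: contraNneq a0 => /diag_eq0 ->.
have unit_diag1 u : u = diag 1 * u by rewrite rmorph1 mul1r.
exists B', f'; split; first split.
- move=> _ [a [u [a0 uU ->]]]; rewrite mulf_neq0 ?diag_neq0 //.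
  by apply: contraTneq uU => ->; rewrite unitr0.
- by move=> u uU; exists 1, u; rewrite oner_neq0.
- move=> _ _ [a [u [a0 uU ->]]] [b [v [b0 vU ->]]]; exists (a * b), (u * v).
  by rewrite mulf_neq0 // unitrM uU vU rmorphM mulrACA.
- move=> _ y [a [u [a0 uU ->]]] [b [v [b0 vU]]]; rewrite -mulrA => e.
  have [c bE] := diag_dvd vU e; exists c, (v / u).
  split; first by apply: contraNneq b0; rewrite bE => ->; rewrite mulr0.
    by rewrite unitrM unitrV vU.
  apply: (mulfI (diag_neq0 _ a0)); apply: (mulrI uU).
  rewrite mulrCA e bE rmorphM -mulrA [RHS]mulrCA.
  by congr (_ * _); rewrite [RHS]mulrCA [u * _]mulrC divrK.
- move=> x k [a [u [a0 uU e]]].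
  (* A component of [x] is, up to units, a root of [a] in [W]. *)
  have [c [v vU aE]] : exists c, exists2 v, v \is a GRing.unit & a = c ^+ k.+1 * v.
    move: uU e; have [h ->] := cls_elim x; have [l ->] := cls_elim u => /cls_unit lU.
    rewrite clsX [diag a]/(cls (fun=> a)) clsM => /clsP e.
    have [i [/= li ei]] := filter_ex (filterI lU e).
    by exists (h i), (l i)^-1; rewrite ?unitrV // ei mulrK.
  have c0 : c != 0.
    by apply: contraNneq a0; rewrite aE => ->; rewrite expr0n mul0r.
  (* Now [x] and [diag c] have associated powers, so they are associated themselves. *)
  have [|||w wU xE] := @associate_of_pow W' x (diag c) (diag v * u) k.
  - exact: diag_neq0.
  - by rewrite unitrM rmorph_unit.
  - by rewrite e aE rmorphM rmorphXn mulrA.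
  by exists c, w.
- move=> _ [a [u [a0 uU ->]]]; rewrite f'E // unitrM uU andbT; exact: rhoU.
- move=> _ _ [a [u [a0 uU ->]]] [b [v [b0 vU ->]]].
  rewrite mulrACA -rmorphM !f'E ?mulf_neq0 ?unitrM ?uU //.
  by rewrite rhoM // mulrACA.
- move=> u uU; rewrite {1}[u]unit_diag1 f'E ?oner_neq0 //.
  by rewrite rho_unit ?unitr1 // -unit_diag1.
move=> a a0; split; first by exists a, 1; rewrite a0 unitr1 mulr1.
by move=> Ba; rewrite -[diag a]mulr1 f'E ?unitr1 // mulr1 rho_ext.
Qed.

End UltrapowerStep.

(** * From a total retraction to a cross-section *)

Section CrossSection.
Variables (W : valuationRingType) (r : W -> W).
Hypothesis Wr : unit_retraction (fun x => x != 0) r.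
Local Notation K := {fraction W}.

Let rK x := frac_retraction (fun x => x != 0) r x.

Let dom (x : nonzero K) : frac_dom (fun x => x != 0) x.
Proof.
have [a [b [b0 e]]] := frac_numden (nz_val x); exists a, b; split=> //.
  by apply: contraNneq (nz_neq0 x) => a0; rewrite e a0 tofrac0 mul0r.
by rewrite e divfK // tofrac_eq0.
Qed.

Let rK_neq0 x : tofrac (rK x) != 0.
Proof.
rewrite tofrac_eq0; apply: contraTneq (frac_retraction_unit Wr x).
by rewrite -/(rK x) => ->; rewrite unitr0.
Qed.

(** As [rK] fixes units, [ratio] kills them and so depends only on the value of [x], which it
    preserves. *)
Let ratio (x : nonzero K) : nonzero K := (x * (Nonzero (rK_neq0 x))^-1)%g.

Let ratioM x y : ratio (x * y)%g = (ratio x * ratio y)%g.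
Proof.
apply: val_inj; rewrite /= /rK (frac_retractionM Wr) //.
by rewrite tofracM invfM mulrACA.
Qed.

Let ratio_unit x (u : W) : u \is a GRing.unit -> nz_val x = tofrac u ->
  ratio x = 1%g.
Proof.
move=> uU e; apply: val_inj; rewrite /= /rK.
have u0 : u != 0 by apply: contraTneq uU => ->; rewrite unitr0.
rewrite (frac_retractionE Wr u0 (oner_neq0 W)) ?tofrac1 ?mulr1 //.
by rewrite !(ur_fid Wr) ?unitr1 // divr1 e divff // tofrac_eq0.
Qed.

Let ratio_valuation x y : valuation x = valuation y -> ratio x = ratio y.
Proof.
move=> /eqP/valuationP[u uU e].
have u0 : tofrac u != 0.
  by rewrite tofrac_eq0; apply: contraTneq uU => ->; rewrite unitr0.
have -> : x = (Nonzero u0 * y)%g by apply: val_inj.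
by rewrite ratioM (ratio_unit uU) // mul1g.
Qed.

Let section (d : value_group W) : nonzero K := ratio (repr d).

Let sectionM : {morph section : d e / (d * e)%g}.
Proof.
move=> d e; rewrite /section -ratioM; apply: ratio_valuation.
by rewrite valuationM !valuation_repr.
Qed.

Lemma cross_section_of_retraction :
  exists s : {multiplicative value_group W -> nonzero K}, is_cross_section s.
Proof.
pose s : {multiplicative value_group W -> nonzero K} :=
  HB.pack section (isMultiplicative.Build _ _ section sectionM).
exists s => d; rewrite -[RHS]valuation_repr; apply/eqP/valuationP.
exists (rK (repr d))^-1; first by rewrite unitrV; apply: frac_retraction_unit.
by rewrite /= mulrC rmorphV //; apply: frac_retraction_unit.
Qed.

End CrossSection.

(** * Gluing the retractions in the colimit *)

Section TowerRetraction.
Variables (V : valuationRingType) (U : nat -> Type).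
Variables (F : forall n, set_system (U n)) (FU : forall n, UltraFilter (@F n)).
Local Notation R := (tower V FU).
Local Notation T := (tower_colim V FU).

Let diag n : {rmorphism R n -> R n.+1} := diag_embedding (FU n) (C := R n).
Let tr n k (h : (n <= k)%N) : {rmorphism R n -> R k} := transition diag h.
Let inn n : {rmorphism R n -> T} :=
  GRing.RMorphism.clone _ _ (@colim_in (tower_system V FU) n) _.

Let innP n k (a : R n) (b : R k) : inn n a = inn k b <->
  exists l (h : (n <= l)%N) (h' : (k <= l)%N), tr h a = tr h' b.
Proof. exact: (@colim_inP (tower_system V FU)). Qed.

Let inn_tr n k (h : (n <= k)%N) a : inn k (tr h a) = inn n a.
Proof. exact: (@colim_in_map (tower_system V FU)). Qed.

Let inn_diag n a : inn n.+1 (diag n a) = inn n a.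
Proof.
by rewrite -(inn_tr (leqnSn n)) /tr (transitionS _ (leqnn n)) transition_id.
Qed.

Variables (B : forall n, R n -> Prop) (f : forall n, R n -> R n).
Hypothesis Bf : forall n, unit_retraction (@B n) (@f n).
Hypothesis B_diag : forall n a, a != 0 -> B (diag n a).
Hypothesis f_diag : forall n a, B a -> f (diag n a) = diag n (f a).

Let tr_compat n k (h : (n <= k)%N) a :
  B a -> B (tr h a) /\ f (tr h a) = tr h (f a).
Proof.
move=> Ba; elim: k h => [|k IH] h.
  have n0 : n = 0%N by apply/eqP; rewrite -leqn0.
  by subst n; rewrite /tr !transition_id.
have [e|nk] := eqVneq n k.+1; first by subst n; rewrite /tr !transition_id.
have {}nk : (n <= k)%N by rewrite -ltnS ltn_neqAle nk.
have [Bk fk] := IH nk; rewrite /tr !(transitionS _ nk) -/(tr nk) f_diag // fk.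
by split=> //; apply: B_diag; apply: (ur_neq0 (Bf k)).
Qed.

(** The union of the retractions of all stages, taken as a relation; [tr_compat] compares two stages
    at a later one. *)
Let graph (x y : T) := exists n (a : R n), [/\ B a, x = inn n a & y = inn n (f a)].

Let graph_fun x y y' : graph x y -> graph x y' -> y = y'.
Proof.
move=> [n [a [Ba -> ->]]] [k [b [Bb /innP[l [h [h' e]]] ->]]].
have [_ fa] := tr_compat h Ba; have [_ fb] := tr_compat h' Bb.
by rewrite -(inn_tr h) -fa e fb inn_tr.
Qed.

(** A representative at stage [n] may lie outside [B], but its image at stage [n.+1] satisfies [B]
    by [B_diag]. *)
Let graph_total x : x != 0 -> exists y, graph x y.
Proof.
have [n [a xE]] := colim_elim x; have {xE}-> : x = inn n a by [].
move=> x0; have a0 : a != 0 by apply: contraNneq x0 => ->; rewrite rmorph0.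
exists (inn n.+1 (f (diag n a))), n.+1, (diag n a).
by rewrite inn_diag; split=> //; apply: B_diag.
Qed.

Let graphM x y x' y' : graph x y -> graph x' y' -> graph (x * x') (y * y').
Proof.
move=> [n [a [Ba -> ->]]] [k [b [Bb -> ->]]].
have [Ba' fa] := tr_compat (leq_maxl n k) Ba.
have [Bb' fb] := tr_compat (leq_maxr n k) Bb.
exists (maxn n k), (tr (leq_maxl n k) a * tr (leq_maxr n k) b); split.
- exact: (ur_mul (Bf _)).
- by rewrite rmorphM !inn_tr.
by rewrite (ur_fM (Bf _)) // fa fb rmorphM !inn_tr.
Qed.

(** An inverse of [x] and the equation [x * y = 1] already exist at some finite stage, whose
    retraction fixes units. *)
Let graph_unit x : x \is a GRing.unit -> graph x x.
Proof.
move=> /unitrPr[y]; have [n [a [b [xE yE]]]] := colim_elim2 x y.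
have {xE}-> : x = inn n a by []; have {yE}-> : y = inn n b by [].
rewrite -rmorphM -(rmorph1 (inn n)) => /innP[k [h [h' e]]].
have aU : tr h a \is a GRing.unit.
  by apply/unitrPr; exists (tr h b); rewrite -rmorphM e rmorph1.
exists k, (tr h a); rewrite (ur_fid (Bf k)) // inn_tr.
by split=> //; apply: (ur_unit (Bf k)).
Qed.

Lemma tower_colim_retraction :
  exists r : T -> T, unit_retraction (fun x => x != 0) r.
Proof.
pose r x := xget 1 [set y | graph x y].
have rE x : x != 0 -> graph x (r x).
  by move=> /graph_total[y gy]; apply: (xgetPex 1 (P := graph x)); exists y.
exists r; split=> //.
- by move=> x; apply: contraTneq => ->; rewrite unitr0.
- by move=> x y x0 y0; rewrite mulf_neq0.
- by move=> x y x0; rewrite mulf_eq0 negb_or x0.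
- by move=> x k; rewrite expf_eq0 negb_and.
- by move=> x /rE[n [a [Ba _ ->]]]; rewrite rmorph_unit // (ur_fU (Bf n)).
- move=> x y x0 y0; apply: (graph_fun (rE _ (mulf_neq0 x0 y0))).
  by apply: graphM; apply: rE.
move=> x xU; apply: graph_fun (graph_unit xU); apply: rE.
by apply: contraTneq xU => ->; rewrite unitr0.
Qed.

End TowerRetraction.

(** * Choice of the ultrafilters and of the retractions *)

(** The ultrafilter at stage [n] must be chosen from the ring at that stage, whereas [tower] takes
    all ultrafilters in advance. So [stage] builds ring and ultrafilter together, and an induction
    identifies it with the tower. *)
Lemma fine_tower (V : valuationRingType) :
  exists (U : nat -> Type) (F : forall n, set_system (U n))
    (FU : forall n, UltraFilter (F n)),
  forall n, exists m : U n -> seq (tower V FU n),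
    forall x, F n [set i | x \in m i].
Proof.
pose G (W : valuationRingType) := projT1 (cid (fine_ultrafilter W)).
have GU W : UltraFilter (G W) by rewrite /G; case: cid => ? [].
have Gfine W x : G W [set s | x \in s] by rewrite /G; case: cid => F0 /= [_].
pose stage := fix stage n : valuationRingType :=
  if n is k.+1 then ultrapower (GU (stage k)) (stage k) else V.
exists (fun n => seq (stage n)), (fun n => G (stage n)), (fun n => GU (stage n)).
move=> n; suff -> : tower V (fun n => GU (stage n)) n = stage n.
  by exists id => x; apply: Gfine.
by elim: n => //= n ->.
Qed.

(** Dependent choice: [ultrapower_step] extends the retraction of each stage to the next one,
    starting from the identity on the units of [V]. *)
Lemma fine_tower_retractions (V : valuationRingType) (U : nat -> Type)
    (F : forall n, set_system (U n)) (FU : forall n, UltraFilter (F n)) :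
  (forall n, exists m : U n -> seq (tower V FU n),
    forall x, F n [set i | x \in m i]) ->
  exists (B : forall n, tower V FU n -> Prop)
         (f : forall n, tower V FU n -> tower V FU n),
  [/\ forall n, unit_retraction (B n) (f n),
      forall n a, a != 0 -> B n.+1 (diag_embedding (FU n) a) &
      forall n a, B n a ->
        f n.+1 (diag_embedding (FU n) a) = diag_embedding (FU n) (f n a)].
Proof.
move=> fine.
pose state n := {Bf : (tower V FU n -> Prop) * (tower V FU n -> tower V FU n) |
  unit_retraction Bf.1 Bf.2}.
have step n (s : state n) : {s' : state n.+1 | forall a, a != 0 ->
    (sval s').1 (diag_embedding (FU n) a) /\
    ((sval s).1 a ->
     (sval s').2 (diag_embedding (FU n) a) = diag_embedding (FU n) ((sval s).2 a))}.
  apply: cid; case: s => -[B f] /= Bf; have [m m_fine] := fine n.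
  have [B' [f' [Bf' compat]]] := ultrapower_step (FU n) Bf m_fine.
  by exists (exist _ (B', f') Bf').
pose s0 : state 0%N := exist _ (_, _) (units_retraction V).
pose s := nat_rect state s0 (fun n s => sval (step n s)).
exists (fun n => (sval (s n)).1), (fun n => (sval (s n)).2).
have compat n a : a != 0 -> _ := svalP (step n (s n)) a.
split=> [n|n a a0|n a Ba]; first exact: (svalP (s n)).
  by have [] := compat n a a0.
by have [_] := compat n a (ur_neq0 (svalP (s n)) Ba); apply.
Qed.

Theorem theoremA10 (V : valuationRingType) :
  exists (U : nat -> Type) (F : forall n, set_system (U n))
         (FU : forall n, UltraFilter (F n)),
  let Vtilde := tower_colim V FU in
  exists s : {multiplicative value_group Vtilde -> nonzero {fraction Vtilde}},
    is_cross_section s.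
Proof.
have [U [F [FU fine]]] := fine_tower V; exists U, F, FU.
have [B [f [Bf B_diag f_diag]]] := fine_tower_retractions fine.
have [r rP] := tower_colim_retraction Bf B_diag f_diag.
exact: cross_section_of_retraction rP.
Qed.
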